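(* Let $H$ be a real Hilbert space, $\Theta$ a finite-dimensional real Hilbert space, $\Phi\in C^2(\Theta;H)$, $F:H\to H$, $\tau>0$, $\varepsilon\ge0$ and $h_k>0$. For fixed $k$ and given $(\theta_k,v_k)\in\Theta\times\Theta$, let $v_{k+1}$ be defined by $$v_{k+1}=\beta_kv_k+M_{\eta,k}^{-1}J_k^*\bigl(f_k-\beta_kJ_kv_k\bigr).$$ Then $v_{k+1}$ is the unique minimizer over $w\in\Theta$ of $$\mathcal{J}_k(w):=\frac12\|J_kw-f_k\|_H^2+\frac{\eta_k^2}{2}\|w-\beta_kv_k\|_\Theta^2,$$ that is, $v_{k+1}=\arg\min_{w\in\Theta}\mathcal{J}_k(w)$.
   Context: $J_k:\Theta\to H$ is the linear map $J_kw:=D\Phi(\theta_k)[w]$, $J_k^*:H\to\Theta$ is its adjoint, and $f_k:=F(\Phi(\theta_k))$. Further, $$\eta_k^2:=\varepsilon^2+\frac{\tau^2}{h_k},\qquad \beta_k:=\frac{\tau^2}{\varepsilon^2h_k+\tau^2},\qquad M_{\eta,k}:=J_k^*J_k+\eta_k^2I .$$ *)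

(* Defs.v *)
From HB Require Import structures.
From mathcomp Require Import all_boot all_order all_algebra sesquilinear.
From mathcomp Require Import all_classical all_reals all_analysis.

Set Implicit Arguments.
Unset Strict Implicit.
Unset Printing Implicit Defensive.

Import Order.TTheory GRing.Theory Num.Theory.
Import numFieldNormedType.Exports.

Local Open Scope classical_set_scope.
Local Open Scope ring_scope.

(* A real Hilbert space is a complete normed space whose norm is induced by a
   (symmetric, bilinear, positive definite) inner product. *)
HB.mixin Record CompleteNormedModule_isHilbert (R : realType) V
    & CompleteNormedModule R V := {
  dotp : {dot V for (@idfun R)} ;
  dotp_norm : forall x : V, dotp x x = `|x| ^+ 2
}.

#[short(type="hilbertType")]
HB.structure Definition Hilbert (R : realType) :=
  {V of CompleteNormedModule R V & CompleteNormedModule_isHilbert R V}.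

#[short(type="finHilbertType")]
HB.structure Definition FinHilbert (R : realType) :=
  {V of Hilbert R V & Vector R V}.

Section Calculus.
Variables (R : realType) (V W : normedModType R).

(* [B] is the differential at [x] of [D f : V -> L(V, W)], where L(V, W) carries
   the operator norm, and [B h w] stands for [(B h) w]: the first clause says
   that [B] is a bounded linear map V -> L(V, W), and the second one that
   ||D f (x + h) - D f x - B h|| = o(||h||), with the operator norm unfolded. *)
Definition is_diff2 (f : V -> W) (x : V) (B : {bilinear V -> V -> W}) : Prop :=
  (exists C : R, forall h w : V, `|B h w| <= C * `|h| * `|w|) /\
  (forall e : R, 0 < e -> \forall h \near (0 : V),
     forall w : V, `|'d f (x + h) w - 'd f x w - B h w| <= e * `|h| * `|w|).

(* The last clause is the continuity of D^2 f for the norm of L(V, L(V, W)). *)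
Definition C2 (f : V -> W) : Prop :=
  (forall x, differentiable f x) /\
  exists D2 : V -> {bilinear V -> V -> W},
    (forall x, is_diff2 f x (D2 x)) /\
    (forall x (e : R), 0 < e -> \forall y \near x,
       forall h w : V, `|D2 y h w - D2 x h w| <= e * `|h| * `|w|).

End Calculus.

(* For a continuous [f], the adjoint is the unique linear map satisfying this
   identity; [get] returns an arbitrary linear map when there is none. *)
Definition adjoint (R : realType) (U V : hilbertType R) (f : {linear U -> V}) :
    {linear V -> U} :=
  get (fun g : {linear V -> U} => forall u v, dotp (f u) v = dotp u (g v)).

Definition argmin (R : realType) (T : Type) (J : T -> R) : set T :=
  [set w | forall u, J w <= J u].

Section Step.
Variables (R : realType) (H : hilbertType R) (Theta : finHilbertType R).
Variables (Phi : Theta -> H) (F : H -> H) (tau eps h : R).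
Implicit Types theta v w : Theta.

Definition eta_sq : R := eps ^+ 2 + tau ^+ 2 / h.

Definition beta : R := tau ^+ 2 / (eps ^+ 2 * h + tau ^+ 2).

Definition M_eta theta : 'End(Theta) :=
  linfun ((adjoint ('d Phi theta) \o 'd Phi theta) \+ eta_sq \*: idfun).

Definition objective theta v w : R :=
  1 / 2 * `|'d Phi theta w - F (Phi theta)| ^+ 2
  + eta_sq / 2 * `|w - beta *: v| ^+ 2.

End Step.

(* Main.v *)
Require Import Defs.
From HB Require Import structures.
From mathcomp Require Import all_boot all_order all_algebra sesquilinear.
From mathcomp Require Import all_classical all_reals all_analysis.
From mathcomp Require Import ring.

(** Write [J] for the derivative, [d := w - beta v] for the displacement of the
candidate [w], [g := f - beta J v] and [M := J^* J + eta^2].  The objective is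
the quadratic [1/2 |J d - g|^2 + eta^2/2 |d|^2] in [d], with gradient
[M d - J^* g].  A quadratic equals its second-order expansion at any point, so
around a solution of the normal equation [M d = J^* g] the linear term
disappears and moving by [z] costs exactly [1/2 |J z|^2 + eta^2/2 |z|^2]
([tikhonov_expansion]).  As [eta^2 > 0] this is positive unless [z = 0], which
gives minimality and uniqueness at once.

Both [J^*] and [M^-1] are total operations whose defining property has to be
earned.  The adjoint exists because the parameters range over a
finite-dimensional space ([adjointP]).  And [M] is injective, since
[<d, M d> = |J d|^2 + eta^2 |d|^2], hence invertible in finite dimension, so
that the step [M^-1 J^* g] does solve the normal equation ([M_eta_invK]). *)

Import Order.TTheory GRing.Theory Num.Theory.
Import numFieldNormedType.Exports.

Local Open Scope classical_set_scope.
Local Open Scope ring_scope.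

Lemma dotpC {R : realType} {V : hilbertType R} (x y : V) : dotp x y = dotp y x.
Proof. by rewrite hermC expr0 mul1r. Qed.

Lemma normD_sq {R : realType} {V : hilbertType R} (x y : V) :
  `|x + y| ^+ 2 = `|x| ^+ 2 + 2 * dotp x y + `|y| ^+ 2.
Proof.
rewrite -!dotp_norm linearDl /= !linearDr /= (dotpC y x); ring.
Qed.

Lemma dotp_eq0 {R : realType} {V : hilbertType R} (x : V) :
  dotp x x = 0 -> x = 0.
Proof. by rewrite dotp_norm => /eqP; rewrite sqrf_eq0 normr_eq0 => /eqP. Qed.

(** The frame operator of a basis [b] replaces the Riesz representation
theorem: [w |-> \sum_i <b_i, w> b_i] records all the products [<b_i, w>] inside
the space itself, so its injectivity, which holds because the inner product is
definite, is enough to realise any prescribed family of products.  Having one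
operator [S] for all families makes the solution linear in [c], as an adjoint
has to be. *)
Lemma exists_dotp_basis {R : realType} (U : finHilbertType R) :
  exists S : 'End(U), forall c : 'I_(\dim {:U}) -> R, forall i : 'I__,
    dotp (vbasis {:U})`_i ((S^-1)%VF (\sum_j c j *: (vbasis {:U})`_j)) = c i.
Proof.
set b := vbasis {:U}.
have b_basis : basis_of {:U} b by exact: vbasisP.
have b_free : free b by exact: basis_free b_basis.
pose frame (w : U) : U := \sum_(i < \dim {:U}) dotp b`_i w *: b`_i.
have frame_linear : linear frame.
  move=> a x y; rewrite /frame scaler_sumr -big_split /=.
  by apply: eq_bigr => i _; rewrite linearPr /= scalerDl scalerA.
pose frameL : {linear U -> U} :=
  HB.pack frame (GRing.isLinear.Build R U U *:%R frame frame_linear).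
exists (linfun frameL) => c i.
have frame_coord w j : coord b j (frame w) = dotp b`_j w.
  by rewrite /frame coord_sum_free.
have ker0 : lker (linfun frameL) == 0%VS.
  rewrite -subv0; apply/subvP => w; rewrite memv_ker lfunE memv0 /= => /eqP w0.
  apply/eqP/dotp_eq0.
  rewrite {1}(coord_basis b_basis (memvf w)) linear_sumlz big1 //= => j _.
  by rewrite linearZl_LR /= -frame_coord w0 linear0 mulr0.
rewrite -frame_coord.
have -> w : frame w = linfun frameL w by rewrite lfunE.
by rewrite lker0_lfunVK // coord_sum_free.
Qed.

(** Finite dimension of the source is what makes the adjoint exist: its value
at [v] only has to have the products [<f b_i, v>] with the vectors [b_i] of a
basis of [U], and [exists_dotp_basis] realises these, linearly in [v]. *)
Lemma adjointP {R : realType} {U : finHilbertType R} {V : hilbertType R}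
    (f : {linear U -> V}) (u : U) (v : V) :
  dotp (f u) v = dotp u (adjoint f v).
Proof.
move: u v; rewrite /adjoint.
apply: (@getPex _ (fun g : {linear V -> U} =>
  forall u v, dotp (f u) v = dotp u (g v))).
have [S SP] := exists_dotp_basis U.
set b := vbasis {:U} in SP.
pose rhs (v : V) : U := \sum_(i < \dim {:U}) dotp (f b`_i) v *: b`_i.
pose g (v : V) : U := (S^-1)%VF (rhs v).
have g_linear : linear g.
  move=> a x y; rewrite /g -linearP /=; congr (_ _).
  rewrite /rhs scaler_sumr -big_split /=.
  by apply: eq_bigr => i _; rewrite linearPr /= scalerDl scalerA.
pose gL : {linear V -> U} :=
  HB.pack g (GRing.isLinear.Build R V U *:%R g g_linear).
exists gL => u v /=.
rewrite (coord_basis (vbasisP _) (memvf u)) linear_sum !linear_sumlz /=.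
apply: eq_bigr => i _.
by rewrite linearZ /= !linearZl_LR /= /g /rhs (SP (fun i => dotp (f b`_i) v)).
Qed.

(** A solution [d] of the normal equation [J^* J d + eta d = J^* g] is a
critical point of the Tikhonov functional [1/2 |J d - g|^2 + eta/2 |d|^2], and
a quadratic functional has no remainder beyond second order there. *)
Lemma tikhonov_expansion {R : realType} {U : finHilbertType R}
    {V : hilbertType R} (J : {linear U -> V}) (eta : R) (g : V) (d z : U) :
  adjoint J (J d) + eta *: d = adjoint J g ->
  1 / 2 * `|J (d + z) - g| ^+ 2 + eta / 2 * `|d + z| ^+ 2 =
  (1 / 2 * `|J d - g| ^+ 2 + eta / 2 * `|d| ^+ 2)
  + (1 / 2 * `|J z| ^+ 2 + eta / 2 * `|z| ^+ 2).
Proof.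
move=> normal_eq.
have critical : dotp (J d - g) (J z) + eta * dotp d z = 0.
  rewrite dotpC adjointP linearB /= -normal_eq opprD addrA subrr add0r.
  by rewrite linearNr linearZr_LR /= dotpC addNr.
rewrite linearD /= addrAC !normD_sq.
have -> : dotp (J d - g) (J z) = - (eta * dotp d z).
  by apply/eqP; rewrite -addr_eq0 critical.
by field.
Qed.

Lemma eta_sq_gt0 {R : realType} {tau : R} (eps : R) {h : R} :
  0 < tau -> 0 < h -> 0 < eta_sq tau eps h.
Proof.
by move=> ? ?; rewrite ltr_wpDl ?sqr_ge0 // divr_gt0 // exprn_gt0.
Qed.

Lemma M_etaE {R : realType} {H : hilbertType R} {Theta : finHilbertType R}
    (Phi : Theta -> H) (tau eps h : R) (theta w : Theta) :
  M_eta Phi tau eps h theta w =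
  adjoint ('d Phi theta) ('d Phi theta w) + eta_sq tau eps h *: w.
Proof. by rewrite /M_eta lfunE. Qed.

(** Pairing [M_eta w] with [w] gives [|J w|^2 + eta^2 |w|^2], so the kernel is
trivial and an endomorphism in finite dimension is then invertible. *)
Lemma M_eta_invK {R : realType} {H : hilbertType R} {Theta : finHilbertType R}
    (Phi : Theta -> H) (tau eps h : R) (theta : Theta) :
  0 < tau -> 0 < h ->
  cancel ((M_eta Phi tau eps h theta)^-1)%VF (M_eta Phi tau eps h theta).
Proof.
move=> tau_gt0 h_gt0; have eta_gt0 := eta_sq_gt0 eps tau_gt0 h_gt0.
apply: lker0_lfunVK; rewrite -subv0; apply/subvP => w.
rewrite memv_ker memv0 => /eqP Mw0; apply/eqP.
have : `|'d Phi theta w| ^+ 2 + eta_sq tau eps h * `|w| ^+ 2 = 0.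
  rewrite -!dotp_norm adjointP -linearZr_LR -linearDr /=.
  by rewrite -M_etaE Mw0 linear0r.
move/eqP; rewrite paddr_eq0 ?(sqr_ge0, mulr_ge0 (ltW eta_gt0) (sqr_ge0 _)) //.
case/andP=> _; rewrite mulrI_eq0 ?sqrf_eq0 ?normr_eq0; first by move/eqP.
by apply/mulfI; rewrite gt_eqF.
Qed.

Theorem proposition4 (R : realType) (H : hilbertType R)
    (Theta : finHilbertType R) (Phi : Theta -> H) (F : H -> H)
    (tau eps hk : R) (thetak vk vk1 : Theta) :
  C2 Phi -> 0 < tau -> 0 <= eps -> 0 < hk ->
  let Jk := 'd Phi thetak in
  let fk := F (Phi thetak) in
  let betak := beta tau eps hk in
  vk1 = betak *: vk
        + ((M_eta Phi tau eps hk thetak)^-1)%VF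
            (adjoint Jk (fk - betak *: Jk vk)) ->
  argmin (objective Phi F tau eps hk thetak vk) = [set vk1].
Proof.
move=> _ tau_gt0 _ hk_gt0 J f b; set d := (_^-1)%VF _ => vk1E.
have eta_gt0 := eta_sq_gt0 eps tau_gt0 hk_gt0.
have normal_eq : adjoint J (J d) + eta_sq tau eps hk *: d
                 = adjoint J (f - b *: J vk).
  by rewrite -M_etaE M_eta_invK.
have expansion w : objective Phi F tau eps hk thetak vk w =
    objective Phi F tau eps hk thetak vk vk1
    + (1 / 2 * `|J (w - vk1)| ^+ 2
       + eta_sq tau eps hk / 2 * `|w - vk1| ^+ 2).
  have residual x : J x - f = J (x - b *: vk) - (f - b *: J vk).
    by rewrite linearB linearZ /= opprB addrA subrK.
  rewrite /objective -/J -/f -/b !residual.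
  have -> : vk1 - b *: vk = d by rewrite vk1E addrC addKr.
  have -> : w - b *: vk = d + (w - vk1).
    by rewrite vk1E opprD [RHS]addrC -!addrA addNr addr0.
  by rewrite tikhonov_expansion.
apply/seteqP; split => w /=.
- (* A minimizer has extra cost at most 0, and that cost dominates
     [eta^2/2 |w - vk1|^2]. *)
  move=> /(_ vk1); rewrite expansion gerDl => cost_le0.
  apply/eqP; rewrite -subr_eq0 -normr_eq0 -sqrf_eq0 eq_le sqr_ge0 andbT.
  rewrite -(pmulr_rle0 _ (divr_gt0 eta_gt0 (ltr0Sn R 1))).
  by apply: le_trans cost_le0; rewrite lerDr mulr_ge0 ?sqr_ge0 // divr_ge0.
- move=> -> u; rewrite (expansion u) lerDl.
  by rewrite addr_ge0 // mulr_ge0 ?sqr_ge0 // divr_ge0 // ltW.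
Qed.
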